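(* For all $n\in\mathbb{N}_0$, $u>0$ and $v>0$, the probability generating function $G(u,v;n)=\mathbb{E}\left[u^{X_n}v^{Y_n}\right]$ of the random walk $(X_n,Y_n)$ on the hexagonal lattice started at the origin is $$G(u,v;n)=F_{i_n}(\tilde u,\tilde v;n)\,u^{i_n a},\qquad \tilde u=u^{\frac32 a}v^{\frac{\sqrt3}{2}a},\quad \tilde v=v^{\sqrt3 a},$$ where $i_n=\frac12\left(1-(-1)^n\right)$ and, for $u,v>0$, $$F_{i_n}(u,v;n)=\left(q_{1,0}+q_{1,2}u+q_{1,1}\frac{u}{v}\right)^{\frac n2-\frac12 i_n}\left(q_{0,0}+q_{0,1}\frac{v}{u}+q_{0,2}\frac1u\right)^{\frac n2+\frac12 i_n}.$$
   Context: Fix $a>0$ and nonnegative numbers $q_{i,r}$ ($i=0,1$; $r=0,1,2$) with $\sum_{r=0}^2 q_{i,r}=1$ for $i=0,1$. The vertices of the hexagonal lattice are $\mathscr V_0\cup\mathscr V_1$, where $$\mathscr V_i=\left\{\left(\tfrac32 aj+ia,\ \tfrac{\sqrt3}{2}aj+\sqrt3 ak\right): j,k\in\mathbb Z\right\},\quad i=0,1.$$ $\{(X_n,Y_n):n\in\mathbb N_0\}$ is the time-homogeneous Markov chain on $\mathscr V_0\cup\mathscr V_1$ which, from a vertex $(x,y)\in\mathscr V_i$, moves in one step to $\left(x+a\cos(\tfrac{2\pi r}{3}+i\pi),\ y+a\sin(\tfrac{2\pi r}{3}+i\pi)\right)$ with probability $q_{i,r}$, $r=0,1,2$ (such a point belongs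 to $\mathscr V_{1-i}$). The initial condition is $(X_0,Y_0)=(0,0)$ almost surely. *)

(* Defs.v *)
From HB Require Import structures.
From mathcomp Require Import all_boot all_order all_algebra.
From mathcomp Require Import all_classical all_reals all_analysis.

Set Implicit Arguments.
Unset Strict Implicit.
Unset Printing Implicit Defensive.

Import Order.TTheory GRing.Theory Num.Theory.
Import numFieldNormedType.Exports.

Local Open Scope classical_set_scope.
Local Open Scope ring_scope.

(* P(B | A), to be used only when P A > 0 *)
Definition cond_prob (d : measure_display) (T : measurableType d)
    (R : realType) (P : probability T R) (A B : set T) : R :=
  fine (P (A `&` B)) / fine (P A).

(* Time-homogeneous Markov chain with (countable) state space S and transition
   function p: P(Z_(n+1) = z_(n+1) | Z_0 = z_0, ..., Z_n = z_n) equals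
   p z_n z_(n+1) whenever the conditioning event has positive probability.
   Only the first n + 2 terms of the sequence z matter. *)
Definition markov_chain (d : measure_display) (T : measurableType d)
    (R : realType) (P : probability T R) (E : Type) (S : set E)
    (p : E -> E -> R) (Z : nat -> T -> E) : Prop :=
  (forall n w, S (Z n w)) /\
  forall (n : nat) (z : nat -> E), (forall k, S (z k)) ->
    let past := [set w | forall k, (k <= n)%N -> Z k w = z k] in
    (0 < P past)%E ->
    cond_prob P past [set w | Z n.+1 w = z n.+1] = p (z n) (z n.+1).

Section Hexagonal.
Variables (R : realType) (a : R) (q : 'I_2 -> 'I_3 -> R).

Definition hex_class (i : 'I_2) : set (R * R) :=
  [set z | exists j k : int,
     z = (3 / 2 * a * j%:~R + i%:R * a,
          Num.sqrt 3 / 2 * a * j%:~R + Num.sqrt 3 * a * k%:~R)].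

Definition hex_vertices : set (R * R) := hex_class 0 `|` hex_class 1.

Definition hex_move (i : 'I_2) (r : 'I_3) (z : R * R) : R * R :=
  (z.1 + a * cos (2 * pi * r%:R / 3 + i%:R * pi),
   z.2 + a * sin (2 * pi * r%:R / 3 + i%:R * pi)).

(* For a > 0 the two classes are disjoint and the three moves out of a vertex
   are distinct, so at most one term is nonzero. *)
Definition hex_transition (z z' : R * R) : R :=
  \sum_(i < 2) \sum_(r < 3)
    \1_(hex_class i) z * q i r * (z' == hex_move i r z)%:R.

Definition parity (n : nat) : R := (1 - (-1) ^+ n) / 2.

(* The exponents are integers, and both bases are positive when u, v > 0 and
   each q i is a probability vector, so powR is the usual power. *)
Definition hex_F (u v : R) (n : nat) : R :=
  (q 1 0 + q 1 2 * u + q 1 1 * (u / v)) `^ (n%:R / 2 - parity n / 2) *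
  (q 0 0 + q 0 1 * (v / u) + q 0 2 * (1 / u)) `^ (n%:R / 2 + parity n / 2).

End Hexagonal.

Definition pgf (d : measure_display) (T : measurableType d) (R : realType)
    (P : probability T R) (X Y : nat -> {RV P >-> R}) (u v : R) (n : nat) :
    \bar R :=
  ('E_P[fun w => (u `^ X n w * v `^ Y n w)%R])%E.

(* Main.v *)
(* From the origin the class of the vertex after n steps is the parity of n, so
   the move at step n is drawn from q (n mod 2), and a monomial u^x v^y is
   multiplied by a factor depending only on that parity and on the move. The
   trajectory of each word of n moves has the product of its move probabilities
   as probability, these trajectories are disjoint and their probabilities add
   up to 1; hence the expectation is a product over the steps of
   \sum_r q i r g i r, whose two values are the bases of F times u^a or u^-a. *)
Require Import Defs.
From HB Require Import structures.
From mathcomp Require Import all_boot all_order all_algebra.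
From mathcomp Require Import all_classical all_reals all_analysis.
From mathcomp Require Import measurable_realfun ring lra zify.

Set Implicit Arguments.
Unset Strict Implicit.
Unset Printing Implicit Defensive.

Import Order.TTheory GRing.Theory Num.Theory.
Import numFieldNormedType.Exports.

Local Open Scope classical_set_scope.
Local Open Scope ring_scope.

(** * Exact values of the step directions *)

Section Trigonometry.
Variable R : realType.

(* cos (2t) = - cos t at t = pi/3, so cos t is the positive root of
   2c^2 + c - 1. *)
Lemma cos_pi3 : cos (pi / 3) = 2^-1 :> R.
Proof.
have pi0 := pi_gt0 R.
have c0 : 0 < cos (pi / 3 : R) by apply: cos_gt0_pihalf; apply/andP; split; lra.
have : cos ((pi / 3 : R) *+ 2) = - cos (pi / 3).
  rewrite (_ : _ *+ 2 = - (pi / 3) + pi); last by rewrite mulr2n; lra.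
  by rewrite cosDpi cosN.
rewrite cos_mulr2n => E.
have : (cos (pi / 3 : R) - 2^-1) * (cos (pi / 3) + 1) = 0 by nra.
move/eqP; rewrite mulf_eq0 => /orP[] /eqP; lra.
Qed.

Lemma sin_pi3 : sin (pi / 3) = Num.sqrt 3 / 2 :> R.
Proof.
have pi0 := pi_gt0 R.
have s0 : 0 < sin (pi / 3 : R) by apply: sin_gt0_pi; apply/andP; split; lra.
have /eqP := sin2cos2 (pi / 3 : R).
rewrite cos_pi3 (_ : 1 - _ = (Num.sqrt 3 / 2) ^+ 2); last first.
  by rewrite exprMn sqr_sqrtr //; field.
by rewrite eqrXn2 ?ltW // => /eqP.
Qed.

(** Coordinates of the unit step [r] out of class 0; class 1 uses the opposite vectors. *)
Definition hex_dx (r : 'I_3) : R := [:: 1; - 2^-1; - 2^-1]`_r.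

Definition hex_dy (r : 'I_3) : R := [:: 0; Num.sqrt 3 / 2; - (Num.sqrt 3 / 2)]`_r.

Lemma hex_dxE (r : 'I_3) : cos (2 * pi * r%:R / 3) = hex_dx r.
Proof.
rewrite /hex_dx; case: r => [[|[|[|//]]] ?] /=.
- by rewrite mulr0 mul0r cos0.
- rewrite (_ : _ / 3 = - (pi / 3) + pi); last by lra.
  by rewrite cosDpi cosN cos_pi3.
- rewrite (_ : _ / 3 = pi / 3 + pi); last by lra.
  by rewrite cosDpi cos_pi3.
Qed.

Lemma hex_dyE (r : 'I_3) : sin (2 * pi * r%:R / 3) = hex_dy r.
Proof.
rewrite /hex_dy; case: r => [[|[|[|//]]] ?] /=.
- by rewrite mulr0 mul0r sin0.
- rewrite (_ : _ / 3 = - (pi / 3) + pi); last by lra.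
  by rewrite sinDpi sinN opprK sin_pi3.
- rewrite (_ : _ / 3 = pi / 3 + pi); last by lra.
  by rewrite sinDpi sin_pi3.
Qed.

End Trigonometry.

(** * Geometry of the vertex classes and of the moves *)

Section Lattice.
Variables (R : realType) (a : R).

Lemma hex_moveE i r (z : R * R) : hex_move a i r z =
  (z.1 + a * ((-1) ^+ i * hex_dx R r), z.2 + a * ((-1) ^+ i * hex_dy R r)).
Proof.
rewrite /hex_move -hex_dxE -hex_dyE; case: i => [[|[|//]] ?] /=.
- by rewrite mul0r addr0 expr0 !mul1r.
- by rewrite mul1r cosDpi sinDpi expr1 !mulN1r.
Qed.

(** Addition in ['I_2] is modulo 2, so [1 + i] is the other class. *)
Lemma hex_class_move i r z :
  hex_class a i z -> hex_class a (1 + i) (hex_move a i r z).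
Proof.
have i1 : (1 + i)%R%:R = 1 - i%:R :> R.
  by case: i => [[|[|//]] ?]; rewrite /= ?subr0 ?subrr.
move=> [j [k ->]]; rewrite hex_moveE /hex_dx /hex_dy /hex_class /mkset i1 {i1}.
case: i => [[|[|//]] ?]; case: r => [[|[|[|//]]] ?] /=.
(* The witnesses are the new lattice coordinates; moves out of class 1 undo those out of class 0. *)
- by exists j, k; congr pair; rewrite /=; lra.
- by exists (j - 1), (k + 1); rewrite !rmorphD /= rmorphN1;
    congr pair; rewrite /=; lra.
- by exists (j - 1), k; rewrite !rmorphD /= rmorphN1; congr pair; rewrite /=; lra.
- by exists j, k; congr pair; rewrite /=; lra.
- by exists (j + 1), (k - 1); rewrite !rmorphD /= rmorphN1;
    congr pair; rewrite /=; lra.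
- by exists (j + 1), k; rewrite !rmorphD /=; congr pair; rewrite /=; lra.
Qed.

Hypothesis a0 : 0 < a.

(** In units of [a / 2] the abscissas are 3j in class 0 and 3j + 2 in class 1, which differ modulo
    3. *)
Lemma hex_class_inj i i' z : hex_class a i z -> hex_class a i' z -> i = i'.
Proof.
have aux (j j' : int) : 3 / 2 * a * j%:~R + a <> 3 / 2 * a * j'%:~R.
  move=> E; have /(mulIf (lt0r_neq0 a0)) : (3 * j + 2)%:~R * a = (3 * j')%:~R * a.
    rewrite !(rmorphD, rmorphM) /=; lra.
  move=> /intr_inj; lia.
move=> [j [k ->]] [j' [k' [E _]]]; apply/val_inj; move: E.
case: i i' => [[|[|//]] ?] [[|[|//]] ?] //=; rewrite !(mul0r, mul1r, addr0).
- by move/esym/aux.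
- by move/aux.
Qed.

(** The horizontal shift separates move 0 from the others, the sign of the vertical shift separates
    1 from 2. *)
Lemma hex_move_inj i r r' z : hex_move a i r z = hex_move a i r' z -> r = r'.
Proof.
have s0 : 0 < Num.sqrt 3 :> R by rewrite sqrtr_gt0.
rewrite !hex_moveE => -[/addrI/(mulfI (lt0r_neq0 a0))/(mulfI _)].
rewrite signr_eq0 => /(_ isT) Ex.
move=> /addrI/(mulfI (lt0r_neq0 a0))/(mulfI _).
rewrite signr_eq0 => /(_ isT) Ey.
apply/val_inj; move: Ex Ey; rewrite /hex_dx /hex_dy.
by case: r r' => [[|[|[|//]]] ?] [[|[|[|//]]] ?] //= Ex Ey; exfalso; lra.
Qed.

Lemma hex_transition_move q i r z : hex_class a i z ->
  hex_transition a q z (hex_move a i r z) = q i r.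
Proof.
move=> iz; rewrite /hex_transition (bigD1 i) //= [X in _ + X]big1 ?addr0.
  rewrite (bigD1 r) //= [X in _ + X]big1 ?addr0; last first.
    move=> r' /eqP r'r; case: eqP => [/hex_move_inj/esym //|_].
    by rewrite mulr0.
  by rewrite indicE mem_set // mul1r eqxx mulr1.
move=> i' /eqP i'i; apply: big1 => r' _.
by rewrite indicE memNset ?mul0r // => /(hex_class_inj iz)/esym.
Qed.

End Lattice.

(** * Words of moves and their weights *)

Section Walk.
Variables (R : realType) (a : R) (q : 'I_2 -> 'I_3 -> R).

(* A word lists the moves of a trajectory from the origin, the last move first.
   The class of a vertex reached in n steps is the parity of n, which is the
   value of n%:R in 'I_2. *)
Fixpoint walk (s : seq 'I_3) : R * R :=
  if s is r :: s' then hex_move a (size s')%:R r (walk s') else (0, 0).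

Fixpoint weight (s : seq 'I_3) : R :=
  if s is r :: s' then weight s' * q (size s')%:R r else 1.

Fixpoint words n : seq (seq 'I_3) :=
  if n is n'.+1 then [seq r :: s | r <- enum 'I_3, s <- words n']
  else [:: [::]].

Lemma size_words n s : s \in words n -> size s = n.
Proof.
elim: n s => [|n IHn] s /=; first by rewrite inE => /eqP->.
by move=> /allpairsP[[r t] /= [_ /IHn <- ->]].
Qed.

Lemma uniq_words n : uniq (words n).
Proof.
elim: n => //= n IHn; apply: allpairs_uniq; rewrite ?enum_uniq //.
by move=> [r s] [r' s'] _ _ /= [-> ->].
Qed.

Lemma walk_class s : hex_class a (size s)%:R (walk s).
Proof.
elim: s => [|r s IHs] /=; first by exists 0, 0; rewrite !(mulr0, mul0r, addr0).
by rewrite mulrS; exact: hex_class_move.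
Qed.

Lemma walk_vertex s : hex_vertices a (walk s).
Proof.
have : (size s)%:R = 0 :> 'I_2 \/ (size s)%:R = 1 :> 'I_2.
  by case: (_%:R) => [[|[|//]] ?]; [left|right]; apply/val_inj.
by case=> E; [left|right]; rewrite -E; exact: walk_class.
Qed.

(** Words of equal length end in the same class, so summing over the last move yields one common
    factor. *)
Lemma sum_words (f : R * R -> R) (g : 'I_2 -> 'I_3 -> R) :
  (forall i r z, f (hex_move a i r z) = f z * g i r) ->
  forall n, \sum_(s <- words n) f (walk s) * weight s =
    f (0, 0) * \prod_(k < n) \sum_(r < 3) q k%:R r * g k%:R r.
Proof.
move=> fM; elim=> [|n IHn]; first by rewrite big_seq1 big_ord0.
rewrite big_ord_recr /= mulrA -IHn big_allpairs_dep /= mulr_sumr big_enum.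
apply: eq_bigr => r _; rewrite mulr_suml [LHS]big_seq [RHS]big_seq.
by apply: eq_bigr => s /size_words <-; rewrite /= fM; ring.
Qed.

Hypothesis hq1 : forall i, \sum_(r < 3) q i r = 1.

Lemma sum_weight n : \sum_(s <- words n) weight s = 1.
Proof.
transitivity (\sum_(s <- words n) cst 1 (walk s) * weight s).
  by apply: eq_bigr => s _; rewrite mul1r.
rewrite (@sum_words _ (fun _ _ => 1)) => [|i r z]; last by rewrite mul1r.
by rewrite mul1r big1 // => k _; under eq_bigr do rewrite mulr1.
Qed.

(** * The law of the walk through its trajectories *)

Variables (d : measure_display) (T : measurableType d) (P : probability T R).
Variables X Y : nat -> {RV P >-> R}.

(** Words start with the last move, so the first [k] moves form a suffix. *)
Definition trajectory (s : seq 'I_3) : set T :=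
  [set w | forall k, (k <= size s)%N ->
    (X k w, Y k w) = walk (drop (size s - k) s)].

Lemma trajectory_cons r s : trajectory (r :: s) =
  trajectory s `&`
  [set w | (X (size s).+1 w, Y (size s).+1 w) = walk (r :: s)].
Proof.
apply/seteqP; split=> w.
  move=> H; split=> [k ks|].
    by have := H k (leqW ks); rewrite /= subSn.
  by have := H (size s).+1 (leqnn _); rewrite subnn drop0.
move=> [H1 H2] k; rewrite leq_eqVlt => /orP[/eqP->|]; first by rewrite subnn drop0.
by rewrite ltnS => ks; rewrite /= subSn //=; exact: H1.
Qed.

Lemma trajectory_nil : trajectory [::] = [set w | (X 0%N w, Y 0%N w) = (0, 0)].
Proof. by apply/seteqP; split=> w /= => [/(_ 0%N isT)|? [|//]]. Qed.

Lemma trajectory_last s w : trajectory s w ->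
  (X (size s) w, Y (size s) w) = walk s.
Proof. by move=> /(_ _ (leqnn _)); rewrite subnn drop0. Qed.

Lemma measurable_XY n z : measurable [set w | (X n w, Y n w) = z].
Proof.
rewrite (_ : [set w | _] = X n @^-1` [set z.1] `&` Y n @^-1` [set z.2]).
  by apply: measurableI; apply: measurable_funPTI; exact: measurable_set1.
apply/seteqP; split=> [w /= <- //|w [/= -> ->]].
by rewrite -surjective_pairing.
Qed.

Lemma measurable_trajectory s : measurable (trajectory s).
Proof.
elim: s => [|r s IHs]; first by rewrite trajectory_nil; exact: measurable_XY.
by rewrite trajectory_cons; apply: measurableI => //; exact: measurable_XY.
Qed.

Hypothesis a0 : 0 < a.

(** By induction the earlier moves agree, so both last moves leave the same vertex and reach the
    same one. *)
Lemma trajectory_inj s s' w : size s = size s' ->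
  trajectory s w -> trajectory s' w -> s = s'.
Proof.
elim: s s' => [|r s IHs] [|r' s'] //= [ss'].
rewrite !trajectory_cons => -[/(IHs _ ss') E w1] [/E <- w2].
move: w1 w2; rewrite /= => -> /(hex_move_inj a0) -> //.
Qed.

Hypothesis hXY : markov_chain P (hex_vertices a) (hex_transition a q)
  (fun n w => (X n w, Y n w)).
Hypothesis h0 : {ae P, forall w, X 0%N w = 0 /\ Y 0%N w = 0}.

Lemma probability_trajectory s : P (trajectory s) = (weight s)%:E.
Proof.
elim: s => [|r s IHs] /=.
  (* For the empty word, the complement is null by the initial condition. *)
  have m := measurable_trajectory [::].
  rewrite -[trajectory _]setCK probability_setC; last exact: measurableC.
  rewrite measure_negligible ?sube0 //; first exact: measurableC.
  apply: negligibleS h0 => w /=; apply: contra_not => -[Xw Yw].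
  by rewrite trajectory_nil /= Xw Yw.
have mr := measurable_XY (size s).+1 (walk (r :: s)).
have ms := measurable_trajectory s.
rewrite trajectory_cons.
(* The Markov property needs a past of positive probability; over a null past both sides vanish. *)
have [P0|P0] := eqVneq (P (trajectory s)) 0%E.
  have -> : weight s = 0 by apply: EFin_inj; rewrite -IHs.
  by rewrite mul0r; apply: subset_measure0 P0 => //; exact: measurableI.
(* Past the end of the word, truncated subtraction keeps this sequence at [walk (r :: s)], so all
   its terms are vertices. *)
have [_ /(_ (size s) (fun k => walk (drop ((size s).+1 - k) (r :: s))))] := hXY.
move=> /(_ (fun k => walk_vertex _)) /=.
rewrite (_ : [set w | forall k, _] = trajectory s); last first.
  by apply/seteqP; split=> w /= H k ks; have := H k ks; rewrite subSn.
rewrite lt0e P0 measure_ge0 subnn subSnn /= !drop0 => /(_ isT).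
rewrite hex_transition_move //; last exact: walk_class.
rewrite /cond_prob IHs /= => /(canRL (divfK _)) H.
rewrite -[LHS]fineK; last by apply: fin_num_measure; exact: measurableI.
rewrite H 1?mulrC //.
by apply: contra_neq P0; rewrite IHs => ->.
Qed.

Lemma integral_walk n (f : R * R -> R) : (forall z, 0 <= f z) ->
  measurable_fun setT (fun w => f (X n w, Y n w)) ->
  (\int[P]_w (f (X n w, Y n w))%:E =
   (\sum_(s <- words n) f (walk s) * weight s)%:E)%E.
Proof.
(* Stated for any [g], as it serves both for [f] and for the constant 1. *)
have sumE (g : R * R -> R) : (forall z, 0 <= g z) ->
    measurable_fun setT (fun w => g (X n w, Y n w)) ->
    (\int[P]_(w in \big[setU/set0]_(s <- words n) trajectory s)
       (g (X n w, Y n w))%:E =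
     (\sum_(s <- words n) g (walk s) * weight s)%:E)%E.
  move=> g0 mg; rewrite ge0_integral_bigsetU.
  - rewrite -sumEFin [LHS]big_seq [RHS]big_seq; apply: eq_bigr => s sn.
    rewrite EFinM -probability_trajectory -integral_cst;
      last exact: measurable_trajectory.
    apply: eq_integral => w /set_mem /trajectory_last.
    by rewrite (size_words sn) => ->.
  - exact: measurable_trajectory.
  - exact: uniq_words.
  - move=> s s' /= /size_words sn /size_words s'n [w [sw s'w]].
    by apply: trajectory_inj sw s'w; rewrite sn s'n.
  - by apply/measurable_EFinP; exact: measurable_funTS.
  - by move=> w _; rewrite lee_fin.
set D := \big[setU/set0]_(s <- words n) trajectory s in sumE *.
have mD : measurable D.
  by apply: bigsetU_measurable => s _; exact: measurable_trajectory.
(* Integrating 1 over [D] gives the total weight of the words, so the complement of [D] is null. *)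
have PD : P D = 1%E.
  rewrite -[LHS]mul1e -(integral_cst P mD 1%:E).
  rewrite [LHS](sumE (cst 1) (fun=> ler01) (measurable_cst _)).
  by under eq_bigr do rewrite mul1r; rewrite sum_weight.
have PDC : P (~` D) = 0%E by rewrite probability_setC // PD subee.
move=> f0 mf.
rewrite -(setUv D) ge0_integral_setU //; last first.
- exact/disj_setPCl.
- by move=> w _; rewrite lee_fin.
- by rewrite setUv; exact/measurable_EFinP.
- exact: measurableC.
rewrite sumE // null_set_integral ?adde0 //.
  exact: measurableC.
by apply/measurable_EFinP; exact: measurable_funTS.
Qed.

End Walk.

(** * Generating function of one step and product over the steps *)

Definition step_monomial (R : realType) (a u v : R) (i : 'I_2) (r : 'I_3) : R :=
  u `^ (a * ((-1) ^+ i * hex_dx R r)) * v `^ (a * ((-1) ^+ i * hex_dy R r)).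

Definition hex_base (R : realType) (q : 'I_2 -> 'I_3 -> R)
    (i : 'I_2) (u v : R) : R :=
  if i == 0 then q 0 0 + q 0 1 * (v / u) + q 0 2 * (1 / u)
  else q 1 0 + q 1 2 * u + q 1 1 * (u / v).

Section GeneratingFunction.
Variables (R : realType) (a : R) (q : 'I_2 -> 'I_3 -> R).
Variables (u v : R) (u0 : 0 < u) (v0 : 0 < v).

Let ut := u `^ (3 / 2 * a) * v `^ (Num.sqrt 3 / 2 * a).
Let vt := v `^ (Num.sqrt 3 * a).

(** With all powers written as exponentials, identities of monomials become linear identities of
    exponents. *)
Let powR_split x y z t : x = z * a -> y = t * a ->
  u `^ x * v `^ y = expR (z * (a * ln u) + t * (a * ln v)).
Proof.
move=> -> ->; rewrite /powR !gt_eqF // -expRD.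
by congr expR; ring.
Qed.

Let utE : ut = expR (3 / 2 * (a * ln u) + Num.sqrt 3 / 2 * (a * ln v)).
Proof. exact: powR_split. Qed.

Let vtE : vt = expR (Num.sqrt 3 * (a * ln v)).
Proof. by rewrite /vt /powR gt_eqF // mulrA. Qed.

Let uaE x : u `^ (x * a) = expR (x * (a * ln u)).
Proof. by rewrite /powR gt_eqF // mulrA. Qed.

(** The monomial of move 0 is the factored power of [u]; the quotients of the others by it are
    monomials in [ut] and [vt]. *)
Lemma sum_step_monomial (i : 'I_2) :
  \sum_(r < 3) q i r * step_monomial a u v i r =
  hex_base q i ut vt * u `^ ((-1) ^+ i * a).
Proof.
rewrite !big_ord_recl big_ord0 addr0.
have -> : lift ord0 ord0 = 1 :> 'I_3 by apply/val_inj.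
have -> : lift ord0 (lift ord0 ord0) = 2 :> 'I_3 by apply/val_inj.
have -> : ord0 = 0 :> 'I_3 by [].
have gE r : step_monomial a u v i r = expR ((-1) ^+ i * hex_dx R r * (a * ln u) +
    (-1) ^+ i * hex_dy R r * (a * ln v)).
  by apply: powR_split; ring.
rewrite !gE uaE /hex_base utE vtE div1r -!expRN -!expRD.
have : i = 0 \/ i = 1 by case: i {gE} => [[|[|//]] ?]; [left|right]; apply/val_inj.
case=> -> /=; rewrite ?modn_small // !mulrDl -!mulrA -!expRD /hex_dx /hex_dy /=.
  by rewrite -addrA; congr (_ * expR _ + (_ * expR _ + _ * expR _)); field.
(* In class 1 the base lists move 2 before move 1. *)
by rewrite [RHS]addrAC -addrA; congr (_ * expR _ + (_ * expR _ + _ * expR _)); field.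
Qed.

(** Among the times below [n], [uphalf n] are even and [n./2] odd; their factors [u^a] and [u^-a]
    cancel in pairs, leaving one [u^a] for odd [n]. *)
Lemma prod_sum_step_monomial n :
  \prod_(k < n) \sum_(r < 3) q k%:R r * step_monomial a u v k%:R r =
  hex_base q 1 ut vt ^+ n./2 * hex_base q 0 ut vt ^+ uphalf n *
  u `^ ((odd n)%:R * a).
Proof.
have natI2 k : k%:R = (odd k)%:R :> 'I_2.
  by elim: k => // k IHk; rewrite mulrS IHk /=; case: (odd k); apply/val_inj.
elim: n => [|n IHn]; first by rewrite big_ord0 !expr0 mul0r powRr0 !mulr1.
rewrite big_ord_recr /= {}IHn sum_step_monomial natI2 !uaE.
rewrite uphalf_half; case: (odd n) => /=; rewrite ?modn_small //.
  rewrite add1n !exprS expr0 mulr1 mul1r mulN1r expRN mul0r expR0.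
  by field; rewrite gt_eqF // expR_gt0.
by rewrite add0n exprS expr0 !mul1r mul0r expR0; ring.
Qed.

End GeneratingFunction.

(** * Integer exponents of F and conclusion *)

Lemma parity_odd (R : realType) n : parity R n = (odd n)%:R.
Proof. by rewrite /parity -signr_odd; case: (odd n); rewrite /= ?expr1 ?expr0; lra. Qed.

(** Both exponents are natural numbers, where [powR] is the ordinary power on nonnegative bases. *)
Lemma hex_F_natpow (R : realType) (q : 'I_2 -> 'I_3 -> R) (u v : R) n :
  (forall i r, 0 <= q i r) -> 0 <= u -> 0 <= v ->
  hex_F q u v n = hex_base q 1 u v ^+ n./2 * hex_base q 0 u v ^+ uphalf n.
Proof.
move=> q0 u0 v0; rewrite /hex_F parity_odd.
have nE : n%:R = (odd n)%:R + 2 * (n./2)%:R :> R.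
  by rewrite -[in LHS](odd_double_half n) natrD -mul2n natrM.
have -> : n%:R / 2 - (odd n)%:R / 2 = (n./2)%:R :> R by rewrite nE; field.
have -> : n%:R / 2 + (odd n)%:R / 2 = (uphalf n)%:R :> R.
  by rewrite uphalf_half natrD nE; field.
by rewrite !powR_mulrn // !(addr_ge0, mulr_ge0) ?invr_ge0.
Qed.

Theorem proposition3p1 (R : realType) (a : R) (ha : 0 < a)
    (q : 'I_2 -> 'I_3 -> R)
    (hq0 : forall i r, 0 <= q i r)
    (hq1 : forall i, \sum_(r < 3) q i r = 1)
    (d : measure_display) (T : measurableType d) (P : probability T R)
    (X Y : nat -> {RV P >-> R})
    (hXY : markov_chain P (hex_vertices a) (hex_transition a q)
             (fun n w => (X n w, Y n w)))
    (h0 : {ae P, forall w, X 0%N w = 0 /\ Y 0%N w = 0})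
    (n : nat) (u v : R) (hu : 0 < u) (hv : 0 < v) :
  let ut := u `^ (3 / 2 * a) * v `^ (Num.sqrt 3 / 2 * a) in
  let vt := v `^ (Num.sqrt 3 * a) in
  pgf X Y u v n = (hex_F q ut vt n * u `^ (parity R n * a))%:E.
Proof.
move=> ut vt; pose f (z : R * R) : R := u `^ z.1 * v `^ z.2.
rewrite hex_F_natpow ?mulr_ge0 ?powR_ge0 // parity_odd -prod_sum_step_monomial //.
rewrite /pgf unlock (@integral_walk _ a q hq1 _ _ _ X Y ha hXY h0 n f).
(* The starting vertex contributes [f (0, 0) = 1]. *)
- rewrite (sum_words _ (f := f) (g := step_monomial a u v)).
    by rewrite /f !powRr0 !mul1r.
  move=> i r z; rewrite hex_moveE /f /= !powRD ?(gt_eqF hu) ?(gt_eqF hv) ?implybT //.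
  by rewrite mulrACA.
- by move=> z; rewrite mulr_ge0 ?powR_ge0.
- by apply: measurable_funM; apply: measurableT_comp (measurable_powRr _) _.
Qed.
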